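(* Fix $m\in\mathbb N$ and $\alpha_0,\dots,\alpha_m\ge0$ with $\alpha_0>0$; whenever the regression scale estimator is considered, assume in addition that $\sum_{k=0}^m\alpha_k=1$ (as required in its definition). Let $n>m$. (a) The three optimization problems defining the sequential, terminal and regression scale estimates admit unique solutions for every function $x\in C[0,1]$. In particular, the sequential, terminal and regression scaling factors and scale estimates are all well defined. (b) The sequential and terminal scale estimators can be represented by the following respective linear combinations of the estimators $\widehat R_k$: $$R^s_n=\beta_{n,n}\widehat R_n+\cdots+\beta_{n,n-m-1}\widehat R_{n-m-1},\qquad R^t_n=\gamma_{n,n}\widehat R_n+\cdots+\gamma_{n,n-m-1}\widehat R_{n-m-1},$$ where $$\beta_{n,k}=\begin{cases}1+\dfrac{\alpha_0}{c^s_n n^2(n-1)}&\text{if }k=n,\\[1ex] \dfrac1{c^s_n nk}\Big(\dfrac{\alpha_{n-k}}{k-1}-\dfrac{\alpha_{n-k-1}}{k+1}\Big)&\text{if }n-m\le k\le n-1,\\[1ex] \dfrac{-\alpha_m}{c^s_n n(n-m)(n-m-1)}&\text{if }k=n-m-1,\end{cases}\qquad c^s_n:=\sum_{k=n-m}^n\frac{\alpha_{n-k}}{k^2(k-1)^2},$$ and $$\gamma_{n,k}=\begin{cases}1+\dfrac1{c^t_n n^2}\displaystyle\sum_{j=n-m}^n\alpha_{n-j}\dfrac{n-j+1}{j-1}&\text{if }k=n,\\[1ex] \dfrac{k-n}{c^t_n n^2k}\alpha_{n-k-1}&\text{otherwise,}\end{cases}\qquad c^t_n:=\sum_{k=n-m}^n\alpha_{n-k}\Big(\frac{n-k+1}{n(k-1)}\Big)^2.$$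 If in addition $\sum_k\alpha_k=1$, then the regression scale estimator is given by $$R^r_n=\frac1{c^r}\sum_{k=0}^m\alpha_k(n-k)(k-a)\widehat R_{n-k},\qquad a=\sum_{k=0}^m\alpha_kk,\quad c^r=a^2-\sum_{k=0}^m\alpha_kk^2.$$ (c) The sequential, terminal and regression scale estimators are scale-invariant. That is, for $n>m$, $x\in C[0,1]$ and $\lambda\ne0$, we have $R^t_n(\lambda x)=R^t_n(x)$, $R^s_n(\lambda x)=R^s_n(x)$ and $R^r_n(\lambda x)=R^r_n(x)$. (d) If $x\in C[0,1]$, with $R$ its roughness exponent, is such that there exists $\lambda\ne0$ for which $|\widehat R_n(\lambda x)-R|=O(a_n)$ as $n\uparrow\infty$ for some sequence $(a_n)$ with $a_n=o(1/n)$, then $|R^s_n(x)-R|$, $|R^t_n(x)-R|$ and $|R^r_n(x)-R|$ are all of the order $O(na_n)$.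
   Context: Constant functions $x$ are excluded throughout. The Faber--Schauder coefficients of $x\in C[0,1]$ are $\theta_{j,k}:=2^{j/2}\big(2x(\tfrac{2k+1}{2^{j+1}})-x(\tfrac{k}{2^j})-x(\tfrac{k+1}{2^j})\big)$ for $j\in\mathbb N_0$, $k=0,\dots,2^j-1$; for $n\in\mathbb N$, $s_n:=\sqrt{\sum_{j=0}^{n-1}\sum_{k=0}^{2^j-1}\theta_{j,k}^2}$ and $\widehat R_n(x):=1-\frac1n\log_2 s_n$. For $n>m$, the sequential scaling factor and sequential scale estimate are $$\lambda^s_n:=\arg\min_{\lambda>0}\sum_{k=n-m}^n\alpha_{n-k}\big(\widehat R_k(\lambda x)-\widehat R_{k-1}(\lambda x)\big)^2,\qquad R^s_n(x):=\widehat R_n(\lambda^s_nx).$$ The terminal scaling factor and terminal scale estimate are $$\lambda^t_n:=\arg\min_{\lambda>0}\sum_{k=n-m}^n\alpha_{n-k}\big(\widehat R_n(\lambda x)-\widehat R_{k-1}(\lambda x)\big)^2,\qquad R^t_n(x):=\widehat R_n(\lambda^t_nx).$$ For weights with $\sum_{k=0}^m\alpha_k=1$, the regression scale estimate and regression scaling factor are $$(R^r_n(x),\lambda^r_n):=\arg\min_{h\in\mathbb R,\ \lambda>0}\sum_{k=0}^m\alpha_k\Big((n-k)(\widehat R_{n-k}(x)-h)-\log_2\lambda\Big)^2.$$ The maps $x\mapsto R^s_n(x),R^t_n(x),R^r_n(x)$ are called the sequential, terminal and regression scale estimators. Roughness exponent: with $\langle x\rangle_n^{(p)}:=\sum_{k=0}^{2^n-1}|x((k+1)2^{-n})-x(k2^{-n})|^p$,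 the function $x$ admits the roughness exponent $R=1/q$ (with $1/\infty:=0$) if there is $q\in[1,\infty]$ with $\lim_n\langle x\rangle_n^{(p)}=0$ for $p>q$ and $\lim_n\langle x\rangle_n^{(p)}=\infty$ for $p<q$.
   Formalization: Every R̂_k occurring in an estimator is assumed defined (k ≥ 1, s_k ≠ 0; so n > m+1 for sequential/terminal); regression also assumes α_0 < 1 (else c^r = 0, no uniqueness); (d) also assumes a_n = O(a_{n+1}), without which it is false. *)

(* Defs.v *)
From mathcomp Require Import all_boot all_order all_algebra.
From mathcomp Require Import all_classical all_reals all_analysis.
Set Implicit Arguments.
Unset Strict Implicit.
Unset Printing Implicit Defensive.
Import Order.TTheory GRing.Theory Num.Theory.
Import numFieldNormedType.Exports.
Local Open Scope classical_set_scope.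
Local Open Scope ring_scope.

(* Elements of C[0,1] are functions [x : R -> R] that are continuous on
   [`[0, 1]]; only their values at dyadic points of [0, 1] are ever used. *)

Definition faber_schauder {R : realType} (x : R -> R) (j k : nat) : R :=
  2 `^ (j%:R / 2) *
  (2 * x ((2 * k + 1)%N%:R / 2 ^+ j.+1) - x (k%:R / 2 ^+ j)
   - x (k.+1%:R / 2 ^+ j)).

Definition fs_norm {R : realType} (n : nat) (x : R -> R) : R :=
  Num.sqrt (\sum_(0 <= j < n) \sum_(0 <= k < 2 ^ j) faber_schauder x j k ^+ 2).

Definition log2 {R : realType} (y : R) : R := ln y / ln 2.

Definition Rhat {R : realType} (n : nat) (x : R -> R) : R :=
  1 - n%:R^-1 * log2 (fs_norm n x).

(* [Rhat n x] is a genuine value only if n is positive and s_n is nonzero: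
   otherwise the total functions [^-1] and [ln] return junk.  The estimators
   below require this for every index k whose [Rhat k] they involve. *)
Definition Rhat_defined {R : realType} (n : nat) (x : R -> R) : Prop :=
  (0 < n)%N /\ fs_norm n x != 0.

Definition scale {R : realType} (l : R) (x : R -> R) : R -> R :=
  fun t => l * x t.

Definition argmin {R : realType} {T : Type} (D : set T) (f : T -> R) : set T :=
  [set t | D t /\ forall u, D u -> f t <= f u].

Section Estimators.
Context {R : realType}.

(* The weights are [alpha 0], ..., [alpha m]; other values are never used. *)
Variables (m : nat) (alpha : nat -> R).

Definition seq_loss (n : nat) (x : R -> R) (l : R) : R :=
  \sum_(n - m <= k < n.+1)
    alpha (n - k) * (Rhat k (scale l x) - Rhat k.-1 (scale l x)) ^+ 2.

Definition term_loss (n : nat) (x : R -> R) (l : R) : R :=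
  \sum_(n - m <= k < n.+1)
    alpha (n - k) * (Rhat n (scale l x) - Rhat k.-1 (scale l x)) ^+ 2.

Definition reg_loss (n : nat) (x : R -> R) (p : R * R) : R :=
  \sum_(0 <= k < m.+1)
    alpha k * ((n - k)%N%:R * (Rhat (n - k) x - p.1) - log2 p.2) ^+ 2.

Definition seq_argmin (n : nat) (x : R -> R) : set R :=
  argmin [set l | 0 < l] (seq_loss n x).

Definition term_argmin (n : nat) (x : R -> R) : set R :=
  argmin [set l | 0 < l] (term_loss n x).

Definition reg_argmin (n : nat) (x : R -> R) : set (R * R) :=
  argmin [set p | 0 < p.2] (reg_loss n x).

(* [get A] is a member of [A] as soon as [A] is nonempty. *)
Definition seq_factor (n : nat) (x : R -> R) : R := get (seq_argmin n x).
Definition seq_estimate (n : nat) (x : R -> R) : R :=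
  Rhat n (scale (seq_factor n x) x).

Definition term_factor (n : nat) (x : R -> R) : R := get (term_argmin n x).
Definition term_estimate (n : nat) (x : R -> R) : R :=
  Rhat n (scale (term_factor n x) x).

Definition reg_estimate (n : nat) (x : R -> R) : R := (get (reg_argmin n x)).1.
Definition reg_factor (n : nat) (x : R -> R) : R := (get (reg_argmin n x)).2.

(* The sequential and terminal losses at n involve [Rhat k] for
   n - m - 1 <= k <= n.  If n <= m.+1 the truncated difference is 0, and the
   condition fails because [Rhat 0] is undefined. *)
Definition scale_defined (n : nat) (x : R -> R) : Prop :=
  forall k, (n - m.+1 <= k <= n)%N -> Rhat_defined k x.

Definition reg_defined (n : nat) (x : R -> R) : Prop :=
  forall k, (n - m <= k <= n)%N -> Rhat_defined k x.

(* [alpha 0 < 1] says that the probability vector is not concentrated at 0.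
   In that excluded case the regression loss vanishes along a whole curve of
   pairs (h, lambda), so that there is no regression estimate. *)
Definition reg_weights : Prop :=
  \sum_(0 <= k < m.+1) alpha k = 1 /\ alpha 0 < 1.

Definition c_seq (n : nat) : R :=
  \sum_(n - m <= k < n.+1) alpha (n - k) / (k%:R ^+ 2 * (k%:R - 1) ^+ 2).

Definition beta (n k : nat) : R :=
  if k == n then
    1 + alpha 0 / (c_seq n * n%:R ^+ 2 * (n%:R - 1))
  else if (n - m <= k)%N then
    1 / (c_seq n * n%:R * k%:R) *
      (alpha (n - k) / (k%:R - 1) - alpha (n - k - 1) / (k%:R + 1))
  else (* k = n - m - 1 *)
    - alpha m / (c_seq n * n%:R * (n%:R - m%:R) * (n%:R - m%:R - 1)).

Definition c_term (n : nat) : R :=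
  \sum_(n - m <= k < n.+1)
    alpha (n - k) * ((n%:R - k%:R + 1) / (n%:R * (k%:R - 1))) ^+ 2.

Definition gamma (n k : nat) : R :=
  if k == n then
    1 + 1 / (c_term n * n%:R ^+ 2) *
      \sum_(n - m <= j < n.+1)
        alpha (n - j) * ((n%:R - j%:R + 1) / (j%:R - 1))
  else
    (k%:R - n%:R) / (c_term n * n%:R ^+ 2 * k%:R) * alpha (n - k - 1).

Definition reg_mean : R := \sum_(0 <= k < m.+1) alpha k * k%:R.

Definition c_reg : R :=
  reg_mean ^+ 2 - \sum_(0 <= k < m.+1) alpha k * k%:R ^+ 2.

End Estimators.

Definition pvariation {R : realType} (p : R) (x : R -> R) (n : nat) : R :=
  \sum_(0 <= k < 2 ^ n) `|x (k.+1%:R / 2 ^+ n) - x (k%:R / 2 ^+ n)| `^ p.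

Definition roughness_exponent {R : realType} (x : R -> R) (rho : R) : Prop :=
  exists q : \bar R,
    [/\ (1%:E <= q)%E,
        rho = (if q is r%:E%E then r^-1 else 0),
        forall p : R, 0 < p -> (q < p%:E)%E ->
          pvariation p x n @[n --> \oo] --> (0 : R)
      & forall p : R, 0 < p -> (p%:E < q)%E ->
          pvariation p x n @[n --> \oo] --> +oo ].

(* Main.v *)
Require Import Defs.
From mathcomp Require Import all_boot all_order all_algebra.
From mathcomp Require Import all_classical all_reals all_analysis.
From mathcomp Require Import ring zify.
Set Implicit Arguments.
Unset Strict Implicit.
Unset Printing Implicit Defensive.
Import Order.TTheory GRing.Theory Num.Theory.
Import numFieldNormedType.Exports.
Local Open Scope classical_set_scope.
Local Open Scope ring_scope.

(** Replacing [x] by [l x] multiplies [s_n] by [|l|], so it changes [Rhat n] by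
    [- log2 |l| / n] ([Rhat_scale]). In the variable [mu = log2 l], which ranges
    over all reals as [l] ranges over the positive ones, each of the three
    losses is therefore a weighted least-squares problem, and everything
    follows from completing squares.

    The sequential and terminal losses are treated as one. Both are
    [\sum_k alpha (n - k) (Rhat (p k) (l x) - Rhat k.-1 (l x)) ^ 2], with [p]
    the identity, respectively the constant [n]. With
    [gap p k = 1 / (k - 1) - 1 / p k] the [k]-th difference is
    [Rhat (p k) x - Rhat k.-1 x + mu * gap p k], so the loss is a quadratic
    polynomial in [mu] with leading coefficient [pair_curv], the sum of the
    [alpha (n - k) * gap p k ^ 2], and half linear coefficient [pair_cross].
    Since [alpha 0 > 0], the curvature is positive and the minimizer is
    [mu = - pair_cross / pair_curv] ([pair_argmin]); hence the estimate is
    [pair_fit = Rhat n x + pair_cross / pair_curv / n]. This is linear in the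
    sequence [Rhat _ x], and collecting the terms (by an Abel summation in the
    sequential case) gives the coefficients [beta] and [gamma]
    ([pair_fit_seq], [pair_fit_term]).

    The regression loss is a weighted linear regression of
    [(n - k) Rhat (n - k) x] on [n - k], with slope [h] and intercept
    [log2 l]. Its solution is unique as soon as the design has positive
    variance, and this variance is [- c_reg] ([c_reg_lt0]).

    Scale invariance holds because adding a multiple of [1 / k] to
    [Rhat k x] moves [pair_cross] by the same multiple of [- pair_curv] and,
    in the regression, changes the intercept only ([pair_fit_shift],
    [reg_fit_shift]). For the rate of convergence one may thus replace [x] by
    [l x], for which all values [Rhat k] entering the estimate at [n] are
    within [C |a n|] of the limit ([bigO_window]). It remains to see that the
    three linear combinations fix constants and have norm of order [n]:
    the cross term is of order [|a n| / n ^ 2] while the curvature is at least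
    of order [1 / n ^ 4] ([pair_fit_close]), and the regression coefficients
    grow linearly in [n] ([reg_fit_close]). *)

(** * Rescaling shifts the estimators by a multiple of 1/n *)

Lemma ln2_gt0 (R : realType) : 0 < ln 2 :> R.
Proof. by apply: ln_gt0; rewrite ltr1n. Qed.

Lemma log2M (R : realType) (a b : R) :
  0 < a -> 0 < b -> log2 (a * b) = log2 a + log2 b.
Proof. by move=> a0 b0; rewrite /log2 lnM ?posrE// mulrDl. Qed.

Lemma log2_powR (R : realType) (e : R) : log2 (2 `^ e) = e.
Proof. by rewrite /log2 ln_powR mulfK// gt_eqF// ln2_gt0. Qed.

Lemma log2_inj (R : realType) (a b : R) :
  0 < a -> 0 < b -> log2 a = log2 b -> a = b.
Proof.
move=> a0 b0 /(divIf _) ab; apply: ln_inj; rewrite ?posrE//.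
by apply: ab; rewrite gt_eqF// ln2_gt0.
Qed.

Lemma fs_norm_scale (R : realType) (n : nat) (l : R) (x : R -> R) :
  fs_norm n (scale l x) = `|l| * fs_norm n x.
Proof.
rewrite /fs_norm -sqrtr_sqr -sqrtrM ?sqr_ge0//; congr Num.sqrt.
rewrite mulr_sumr; apply: eq_bigr => j _.
rewrite mulr_sumr; apply: eq_bigr => k _.
by rewrite /faber_schauder /scale; ring.
Qed.

Lemma Rhat_defined_scale (R : realType) (n : nat) (l : R) (x : R -> R) :
  l != 0 -> Rhat_defined n x -> Rhat_defined n (scale l x).
Proof. by move=> l0 [n0 sx]; split; rewrite // fs_norm_scale mulf_neq0// normr_eq0. Qed.

Lemma Rhat_scale (R : realType) (n : nat) (l : R) (x : R -> R) :
  l != 0 -> Rhat_defined n x ->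
  Rhat n (scale l x) = Rhat n x - log2 `|l| * n%:R^-1.
Proof.
move=> l0 [n0 sx]; rewrite /Rhat fs_norm_scale log2M ?normr_gt0//; first by ring.
by rewrite lt0r sx sqrtr_ge0.
Qed.

Lemma Rhat_scale_gt0 (R : realType) (n : nat) (l : R) (x : R -> R) :
  0 < l -> Rhat_defined n x ->
  Rhat n (scale l x) = Rhat n x - log2 l * n%:R^-1.
Proof. by move=> l0 dx; rewrite Rhat_scale ?gt_eqF// gtr0_norm. Qed.

(** * Minimizers of sums of squares *)

(** Once squares are completed, the loss is a constant plus a residual that
    vanishes at exactly one admissible point. *)
Lemma argmin_residual (R : realType) (T : Type) (D : set T) (f N : T -> R)
    (q : R) (t0 : T) :
  D t0 -> (forall t, D t -> f t = q + N t) -> (forall t, D t -> 0 <= N t) ->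
  (forall t, D t -> N t = 0 <-> t = t0) ->
  argmin D f = [set t0].
Proof.
move=> Dt0 fE N0 Neq0; have Nt0 : N t0 = 0 by apply/Neq0.
apply/seteqP; split => [t [Dt tmin]|_ ->].
  apply/(Neq0 _ Dt)/eqP; rewrite eq_le N0// andbT.
  by have := tmin _ Dt0; rewrite !fE// Nt0 addr0 gerDl.
by split=> // u Du; rewrite !fE// Nt0 addr0 lerDl N0.
Qed.

Lemma set1_exists_unique (T : Type) (A : set T) (t : T) :
  A = [set t] -> exists! u, A u.
Proof. by move=> ->; exists t; split=> // u. Qed.

Lemma get_set1 (T : pointedType) (A : set T) (t : T) : A = [set t] -> get A = t.
Proof. by move=> ->; apply: get_unique. Qed.

(** * The sequential and terminal estimators in common *)

(** The sequential loss is the case [p = id], the terminal loss the case where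
    [p] is the constant [n]. *)
Definition pair_loss {R : realType} (m : nat) (alpha : nat -> R)
    (p : nat -> nat) (n : nat) (x : R -> R) (l : R) : R :=
  \sum_(n - m <= k < n.+1)
    alpha (n - k)%N * (Rhat (p k) (scale l x) - Rhat k.-1 (scale l x)) ^+ 2.

(** The derivative of [Rhat (p k) (scale l x) - Rhat k.-1 (scale l x)] with
    respect to [log2 l]. *)
Definition gap {R : realType} (p : nat -> nat) (k : nat) : R :=
  (k.-1)%:R^-1 - (p k)%:R^-1.

Definition pair_curv {R : realType} (m : nat) (alpha : nat -> R)
    (p : nat -> nat) (n : nat) : R :=
  \sum_(n - m <= k < n.+1) alpha (n - k)%N * gap p k ^+ 2.

Definition pair_cross {R : realType} (m : nat) (alpha : nat -> R)
    (p : nat -> nat) (n : nat) (r : nat -> R) : R :=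
  \sum_(n - m <= k < n.+1) alpha (n - k)%N * gap p k * (r (p k) - r k.-1).

(** The value of [r n - mu / n] at the minimizer
    [mu = - pair_cross / pair_curv]. *)
Definition pair_fit {R : realType} (m : nat) (alpha : nat -> R)
    (p : nat -> nat) (n : nat) (r : nat -> R) : R :=
  r n + pair_cross m alpha p n r / pair_curv m alpha p n / n%:R.

(** What the two choices of [p] share: it makes every gap nonnegative, keeps the
    indices in the window where the estimators are defined, and forces
    [p n = n]. *)
Definition forward (m n : nat) (p : nat -> nat) : Prop :=
  forall k, (n - m <= k <= n)%N -> (k <= p k <= n)%N.

Lemma forward_id (m n : nat) : forward m n id.
Proof. by move=> k; lia. Qed.

Lemma forward_const (m n : nat) : forward m n (fun=> n).
Proof. by move=> k; lia. Qed.

(** Otherwise the window of indices would contain 0, where [Rhat] is undefined. *)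
Lemma scale_defined_gt {R : realType} (m n : nat) (x : R -> R) :
  scale_defined m n x -> (m.+1 < n)%N.
Proof.
move=> dx; rewrite ltnNge; apply/negP => nm.
by have [] : Rhat_defined 0 x by apply: dx; lia.
Qed.

Lemma gap_last (R : realType) (m n : nat) (p : nat -> nat) :
  (1 < n)%N -> forward m n p -> gap p n = (n%:R * n.-1%:R)^-1 :> R.
Proof.
move=> n1 pf; rewrite /gap; have -> : p n = n by have := pf n; lia.
case: n n1 {pf} => [|[|n]]//= _.
by rewrite -[n.+2%:R]natr1; field; rewrite nat1r natr1 !pnatr_eq0.
Qed.

(** As [p k <= n], the gap is at most
    [1 / (k - 1) - 1 / n = (n - k + 1) / (n (k - 1))]; the numerator is at most
    [m + 1] and, for large [n], [k - 1] is at least [n / 2]. *)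
Lemma gap_bounds (R : realType) (m n k : nat) (p : nat -> nat) :
  (m.+1.*2 <= n)%N -> forward m n p -> (n - m <= k <= n)%N -> (1 < n)%N ->
  0 <= (gap p k : R) <= 2 * m.+1%:R / n%:R ^+ 2.
Proof.
move=> mn pf nk n1; have /andP[k3 k4] := pf _ nk.
have k1 : (0 < k.-1)%N by lia.
have k10 : 0 < k.-1%:R :> R by rewrite ltr0n.
have pk0 : 0 < (p k)%:R :> R by rewrite ltr0n; lia.
have n0 : 0 < n%:R :> R by rewrite ltr0n; lia.
apply/andP; split.
  by rewrite /gap subr_ge0 lef_pV2 ?posrE// ler_nat; lia.
apply: (@le_trans _ _ (k.-1%:R^-1 - n%:R^-1)).
  by rewrite lerD2l lerN2 lef_pV2 ?posrE// ler_nat.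
have -> : k.-1%:R^-1 - n%:R^-1 = (n - k.-1)%:R * (n%:R * k.-1%:R)^-1 :> R.
  by rewrite natrB; [field; rewrite !gt_eqF|lia].
have -> : 2 * m.+1%:R / n%:R ^+ 2 = m.+1%:R * (2 / n%:R ^+ 2) :> R by ring.
apply: ler_pM => //; rewrite ?ler0n ?invr_ge0 ?mulr_ge0 ?ler0n// ?ler_nat; first lia.
rewrite -[leRHS]invf_div lef_pV2 ?posrE ?mulr_gt0 ?exprn_gt0 ?invr_gt0//.
rewrite expr2 -mulrA ler_pM2l// ler_pdivrMr// -natrM ler_nat; lia.
Qed.

Section Pair.
Context {R : realType} (m : nat) (alpha : nat -> R).
Hypothesis alpha_ge0 : forall k, (k <= m)%N -> 0 <= alpha k.
Hypothesis alpha0_gt0 : 0 < alpha 0%N.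

(** The last summand, which carries the positive weight [alpha 0]. *)
Lemma pair_curv_ge (p : nat -> nat) (n : nat) :
  (1 < n)%N -> forward m n p ->
  alpha 0%N * (n%:R * n.-1%:R) ^- 2 <= pair_curv m alpha p n.
Proof.
move=> n1 pf; rewrite /pair_curv big_nat_recr ?leq_subr//= subnn (gap_last _ n1 pf).
rewrite exprVn lerDr big_nat; apply: sumr_ge0 => k /andP[k1 k2].
by rewrite mulr_ge0 ?sqr_ge0// alpha_ge0//; lia.
Qed.

Lemma pair_curv_gt0 (p : nat -> nat) (n : nat) :
  (1 < n)%N -> forward m n p -> 0 < pair_curv m alpha p n.
Proof.
move=> n1 pf; apply: lt_le_trans (pair_curv_ge n1 pf).
by rewrite mulr_gt0// invr_gt0 exprn_gt0// mulr_gt0// ltr0n; lia.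
Qed.

(** Completing the square in [log2 l]. *)
Lemma pair_lossE (p : nat -> nat) (n : nat) (x : R -> R) (l : R) :
  scale_defined m n x -> forward m n p -> 0 < l ->
  let r := Rhat^~ x in
  pair_loss m alpha p n x l =
    \sum_(n - m <= k < n.+1) alpha (n - k)%N * (r (p k) - r k.-1) ^+ 2
    - pair_cross m alpha p n r ^+ 2 / pair_curv m alpha p n
    + pair_curv m alpha p n *
      (log2 l + pair_cross m alpha p n r / pair_curv m alpha p n) ^+ 2.
Proof.
move=> dx pf l0 r; have mn := scale_defined_gt dx.
have c0 : pair_curv m alpha p n != 0 by rewrite gt_eqF// pair_curv_gt0//; lia.
transitivity (\sum_(n - m <= k < n.+1) alpha (n - k)%N * (r (p k) - r k.-1) ^+ 2
  + (log2 l ^+ 2 * pair_curv m alpha p n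
     + 2 * log2 l * pair_cross m alpha p n r)); last by field.
rewrite /pair_curv /pair_cross !mulr_sumr -!big_split/=.
rewrite /pair_loss !big_nat; apply: eq_bigr => k /andP[k1 k2].
have /andP[k3 k4] : (k <= p k <= n)%N by apply: pf; lia.
rewrite !Rhat_scale_gt0//; [|by apply: dx; lia..].
by rewrite /gap /r; ring.
Qed.

Lemma pair_argmin (p : nat -> nat) (n : nat) (x : R -> R) :
  scale_defined m n x -> forward m n p ->
  argmin [set l | 0 < l] (pair_loss m alpha p n x) =
    [set 2 `^ (- (pair_cross m alpha p n (Rhat^~ x) / pair_curv m alpha p n))].
Proof.
move=> dx pf; have mn := scale_defined_gt dx.
have c0 : 0 < pair_curv m alpha p n by apply: pair_curv_gt0 => //; lia.
apply: (argmin_residual _ (fun l l0 => pair_lossE dx pf l0)).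
- by rewrite /= powR_gt0.
- by move=> l _; rewrite mulr_ge0 ?sqr_ge0// ltW.
move=> l /= l0; split => [/eqP|->].
  rewrite mulf_eq0 gt_eqF//= expf_eq0/= addr_eq0 => /eqP le.
  by apply: log2_inj => //; rewrite ?powR_gt0// log2_powR.
by rewrite log2_powR addNr expr0n/= mulr0.
Qed.

Lemma Rhat_argmin (p : nat -> nat) (n : nat) (x : R -> R) :
  scale_defined m n x -> forward m n p ->
  Rhat n (scale (get (argmin [set l | 0 < l] (pair_loss m alpha p n x))) x) =
    pair_fit m alpha p n (Rhat^~ x).
Proof.
move=> dx pf; have mn := scale_defined_gt dx.
rewrite (get_set1 (pair_argmin dx pf)).
rewrite Rhat_scale_gt0 ?powR_gt0//; last by apply: dx; lia.
by rewrite log2_powR /pair_fit mulNr opprK.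
Qed.

(** The shift [- mu / k] changes [pair_cross] by [mu * pair_curv], and the
    resulting [mu / n] cancels the shift of [r n]. *)
Lemma pair_fit_shift (p : nat -> nat) (n : nat) (r r' : nat -> R) (mu : R) :
  (m.+1 < n)%N -> forward m n p ->
  (forall k, (n - m.+1 <= k <= n)%N -> r' k = r k - mu * k%:R^-1) ->
  pair_fit m alpha p n r' = pair_fit m alpha p n r.
Proof.
move=> mn pf rr'.
have c0 : pair_curv m alpha p n != 0 by rewrite gt_eqF// pair_curv_gt0//; lia.
have n0 : n%:R != 0 :> R by rewrite pnatr_eq0; lia.
have crossE : pair_cross m alpha p n r' =
    pair_cross m alpha p n r + mu * pair_curv m alpha p n.
  rewrite /pair_curv /pair_cross mulr_sumr -big_split/= !big_nat.
  apply: eq_bigr => k /andP[k1 k2].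
  have /andP[k3 k4] : (k <= p k <= n)%N by apply: pf; lia.
  by rewrite !rr'; [rewrite /gap; ring|lia..].
by rewrite /pair_fit crossE rr'; [field; rewrite c0 n0|lia].
Qed.

(** The cross term is of order [e / n ^ 2] and the curvature is at least of
    order [n ^ -4]; hence the factor [n] lost in the correction. *)
Lemma pair_fit_close (p : nat -> nat) (n : nat) (r : nat -> R) (rho e : R) :
  (m.+1.*2 <= n)%N -> (1 < n)%N -> forward m n p ->
  (forall k, (n - m.+1 <= k <= n)%N -> `|r k - rho| <= e) ->
  `|pair_fit m alpha p n r - rho| <=
    (1 + 4 * m.+1%:R * (\sum_(0 <= k < m.+1) alpha k) / alpha 0%N)
    * (n%:R * e).
Proof.
move=> mn n1 pf re.
set S := \sum_(0 <= k < m.+1) alpha k.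
have n0 : 0 < n%:R :> R by rewrite ltr0n; lia.
have n1' : 1 <= n%:R :> R by rewrite ler1n; lia.
have e0 : 0 <= e by apply: le_trans (re n _) => //; lia.
have S0 : 0 <= S.
  by rewrite /S big_nat; apply: sumr_ge0 => k k1; apply: alpha_ge0; lia.
have SE : S = \sum_(n - m <= k < n.+1) alpha (n - k)%N.
  rewrite /S big_nat_rev/= add0n -[(n - m)%N]add0n big_addn.
  have -> : (n.+1 - (n - m) = m.+1)%N by lia.
  by rewrite !big_nat; apply: eq_bigr => k k1; congr alpha; lia.
have crossB : `|pair_cross m alpha p n r| <=
    S * (2 * m.+1%:R / n%:R ^+ 2) * (2 * e).
  rewrite SE !mulr_suml; apply: le_trans (ler_norm_sum _ _ _) _.
  rewrite !big_nat; apply: ler_sum => k k1.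
  have /andP[k3 k4] : (k <= p k <= n)%N by apply: pf; lia.
  have /andP[g0 g1] : 0 <= (gap p k : R) <= 2 * m.+1%:R / n%:R ^+ 2.
    by apply: (gap_bounds R mn pf _ n1); lia.
  have a0 : 0 <= alpha (n - k)%N by apply: alpha_ge0; lia.
  rewrite !normrM (ger0_norm a0) (ger0_norm g0).
  apply: ler_pM; rewrite ?mulr_ge0//; first by rewrite ler_wpM2l.
  have -> : r (p k) - r k.-1 = (r (p k) - rho) - (r k.-1 - rho) by ring.
  apply: le_trans (ler_normB _ _) _.
  by rewrite mulr_natl mulr2n lerD// re//; lia.
have c0 : 0 < pair_curv m alpha p n by apply: pair_curv_gt0.
have cB : (pair_curv m alpha p n)^-1 <= n%:R ^+ 4 / alpha 0%N.
  rewrite -[leRHS]invf_div lef_pV2 ?posrE// ?divr_gt0 ?exprn_gt0//.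
  apply: le_trans (pair_curv_ge n1 pf); rewrite ler_pM2l//.
  have n10 : 0 < n.-1%:R :> R by rewrite ltr0n; lia.
  rewrite lef_pV2 ?posrE ?exprn_gt0 ?mulr_gt0//.
  rewrite (_ : n%:R ^+ 4 = (n%:R * n%:R) ^+ 2); last by ring.
  by rewrite lerXn2r ?nnegrE ?mulr_ge0 ?ler0n// ler_pM2l// ler_nat leq_pred.
rewrite /pair_fit addrAC; apply: le_trans (ler_normD _ _) _.
rewrite [leRHS]mulrDl mul1r; apply: lerD.
  by apply: le_trans (re n _) _; [lia|rewrite ler_peMl].
rewrite 2!normrM !normfV (gtr0_norm c0) (gtr0_norm n0) ler_pdivrMr//.
apply: le_trans (ler_pM _ _ crossB cB) _; rewrite ?invr_ge0 ?(ltW c0)//.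
rewrite le_eqVlt; apply/orP; left; apply/eqP; field.
by rewrite !gt_eqF.
Qed.

End Pair.

(** * The coefficients of the sequential and terminal estimators *)

Section Coefficients.
Context {R : realType} (m : nat) (alpha : nat -> R).

Lemma c_seqE (n : nat) : (m.+1 < n)%N -> c_seq m alpha n = pair_curv m alpha id n.
Proof.
move=> mn; rewrite /c_seq /pair_curv !big_nat; apply: eq_bigr => k nk.
rewrite /gap; case: k nk => [|[|k]]/= nk; [lia|lia|].
by rewrite -[k.+2%:R]natr1; field; rewrite nat1r natr1 !pnatr_eq0.
Qed.

Lemma c_termE (n : nat) :
  (m.+1 < n)%N -> c_term m alpha n = pair_curv m alpha (fun=> n) n.
Proof.
move=> mn; rewrite /c_term /pair_curv !big_nat; apply: eq_bigr => k nk.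
rewrite /gap; case: k nk => [|[|k]]/= nk; [lia|lia|].
have n0 : n%:R != 0 :> R by rewrite pnatr_eq0; lia.
by rewrite -[k.+2%:R]natr1; field; rewrite n0 ?addrK nat1r pnatr_eq0.
Qed.

(** Abel summation; the boundary terms give the first and the last of the
    coefficients [beta]. *)
Lemma sum_by_parts (u r : nat -> R) (a b : nat) : (a < b)%N ->
  \sum_(a.+1 <= k < b.+1) u k * (r k - r k.-1) =
  u b * r b + \sum_(a.+1 <= k < b) (u k - u k.+1) * r k - u a.+1 * r a.
Proof.
move=> ab; under eq_bigr do rewrite mulrBr.
rewrite sumrB big_nat_recr//= [X in _ - X]big_add1/= (big_ltn ab).
under [in RHS]eq_bigr do rewrite mulrBl.
by rewrite sumrB; ring.
Qed.

Hypothesis alpha_ge0 : forall k, (k <= m)%N -> 0 <= alpha k.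
Hypothesis alpha0_gt0 : 0 < alpha 0%N.

Lemma pair_fit_seq (n : nat) (r : nat -> R) : (m.+1 < n)%N ->
  pair_fit m alpha id n r =
    \sum_(n - m.+1 <= k < n.+1) beta m alpha n k * r k.
Proof.
move=> mn; have c0 : c_seq m alpha n != 0.
  by rewrite c_seqE// gt_eqF// pair_curv_gt0//; [lia|exact: forward_id].
have n0 : n%:R != 0 :> R by rewrite pnatr_eq0; lia.
have n10 : n%:R - 1 != 0 :> R by rewrite subr_eq0 pnatr_eq1; lia.
have nE : (n - m)%N = (n - m.+1).+1 by lia.
(* [1 / (k (k - 1))] is the gap [1 / (k - 1) - 1 / k]. *)
pose u k : R := alpha (n - k)%N / (k%:R * (k%:R - 1)).
have -> : pair_fit m alpha id n r =
    r n + (\sum_((n - m.+1).+1 <= k < n.+1) u k * (r k - r k.-1))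
      / c_seq m alpha n / n%:R.
  rewrite /pair_fit c_seqE// /pair_cross nE; congr (_ + _ / _ / _).
  rewrite !big_nat; apply: eq_bigr => k nk.
  rewrite /u /gap; case: k nk => [|[|k]]/= nk; [lia|lia|].
  by rewrite -[k.+2%:R]natr1; field; rewrite addrK nat1r natr1 !pnatr_eq0.
rewrite sum_by_parts; last by lia.
rewrite [RHS]big_nat_recr/=; last by lia.
rewrite [in RHS]big_ltn; last by lia.
set B := \sum_((n - m.+1).+1 <= k < n) beta _ _ _ _ * _.
have -> : B = (\sum_((n - m.+1).+1 <= k < n) (u k - u k.+1) * r k)
    / (c_seq m alpha n * n%:R).
  rewrite /B mulr_suml !big_nat; apply: eq_bigr => k nk.
  rewrite /beta ifF; last by lia.
  rewrite ifT; last by lia.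
  rewrite /u (_ : (n - k.+1 = n - k - 1)%N); last by lia.
  case: k nk => [|[|k]]/= nk; [lia|lia|].
  rewrite -[k.+3%:R]natr1 -[k.+2%:R]natr1; field.
  by rewrite c0 n0 /= ?addrK ?nat1r ?natr1 !pnatr_eq0.
rewrite /beta eqxx ifF; last by lia.
rewrite ifF; last by lia.
rewrite /u subnn -nE (_ : (n - (n - m) = m)%N); last by lia.
have nm0 : n%:R - m%:R != 0 :> R.
  by rewrite -natrB ?pnatr_eq0; lia.
have nm10 : n%:R - m%:R - 1 != 0 :> R.
  by rewrite -natrB; [rewrite subr_eq0 pnatr_eq1; lia|lia].
rewrite natrB; last by lia.
by field; rewrite c0 n0 n10 nm0 nm10.
Qed.

Lemma pair_fit_term (n : nat) (r : nat -> R) : (m.+1 < n)%N ->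
  pair_fit m alpha (fun=> n) n r =
    \sum_(n - m.+1 <= k < n.+1) gamma m alpha n k * r k.
Proof.
move=> mn; have c0 : c_term m alpha n != 0.
  by rewrite c_termE// gt_eqF// pair_curv_gt0//; [lia|exact: forward_const].
have n0 : n%:R != 0 :> R by rewrite pnatr_eq0; lia.
have nE : (n - m)%N = (n - m.+1).+1 by lia.
pose v k : R := alpha (n - k)%N * ((n%:R - k%:R + 1) / (k%:R - 1)).
have -> : pair_fit m alpha (fun=> n) n r =
    r n + ((\sum_(n - m <= k < n.+1) v k) * r n
           - \sum_(n - m.+1 <= k < n) v k.+1 * r k)
      / (c_term m alpha n * n%:R ^+ 2).
  have -> : \sum_(n - m.+1 <= k < n) v k.+1 * r k =
      \sum_(n - m <= k < n.+1) v k * r k.-1 by rewrite nE big_add1.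
  rewrite mulr_suml -sumrB /pair_fit c_termE// -[in LHS]mulrA -invfM.
  rewrite [in RHS]expr2 [in RHS]mulrA [in RHS]invfM [in RHS]mulrA.
  congr (_ + _); rewrite [in LHS]mulrC [in RHS]mulrAC [in RHS]mulrC.
  congr (_ * _); rewrite /pair_cross mulr_suml !big_nat; apply: eq_bigr => k nk.
  rewrite /v /gap; case: k nk => [|[|k]]/= nk; [lia|lia|].
  by rewrite -[k.+2%:R]natr1; field; rewrite n0 ?addrK nat1r pnatr_eq0.
rewrite [RHS]big_nat_recr/=; last by lia.
set B := \sum_(n - m.+1 <= k < n) gamma _ _ _ _ * _.
have -> : B = - ((\sum_(n - m.+1 <= k < n) v k.+1 * r k)
    / (c_term m alpha n * n%:R ^+ 2)).
  rewrite /B mulr_suml -sumrN !big_nat; apply: eq_bigr => k nk.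
  rewrite /gamma ifF; last by lia.
  rewrite /v (_ : (n - k.+1 = n - k - 1)%N); last by lia.
  case: k nk => [|k]/= nk; first lia.
  by rewrite -[k.+2%:R]natr1; field; rewrite c0 n0 ?addrK ?nat1r ?pnatr_eq0.
by rewrite /gamma eqxx; field; rewrite c0 n0.
Qed.

End Coefficients.

(** * The regression estimator *)

Section Regression.
Context {R : realType} (m : nat) (alpha : nat -> R).

Definition reg_fit (n : nat) (r : nat -> R) : R :=
  1 / c_reg m alpha *
  \sum_(0 <= k < m.+1)
    alpha k * (n%:R - k%:R) * (k%:R - reg_mean m alpha) * r (n - k)%N.

(** The weighted mean of the responses [(n - k) r (n - k)]. *)
Definition reg_ybar (n : nat) (r : nat -> R) : R :=
  \sum_(0 <= k < m.+1) alpha k * (n%:R - k%:R) * r (n - k)%N.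

(** Since [(n - k) * (mu / (n - k)) = mu], the shift adds a constant to all
    responses, and the weights [alpha k * (k - reg_mean)] sum to 0. *)
Lemma reg_fit_shift (n : nat) (r r' : nat -> R) (mu : R) : (m < n)%N ->
  reg_weights m alpha ->
  (forall k, (n - m <= k <= n)%N -> r' k = r k - mu * k%:R^-1) ->
  reg_fit n r' = reg_fit n r.
Proof.
move=> mn [sum1 _] rr'; rewrite /reg_fit; congr (_ * _).
transitivity (\sum_(0 <= k < m.+1)
    alpha k * (n%:R - k%:R) * (k%:R - reg_mean m alpha) * r (n - k)%N
  - mu * (\sum_(0 <= k < m.+1) alpha k * k%:R
          - reg_mean m alpha * \sum_(0 <= k < m.+1) alpha k)).
  move: (reg_mean m alpha) => mean; rewrite mulr_sumr -sumrB mulr_sumr -sumrB.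
  rewrite !big_nat; apply: eq_bigr => k k1.
  rewrite rr'; last by lia.
  have nk0 : n%:R - k%:R != 0 :> R by rewrite -natrB ?pnatr_eq0; lia.
  by rewrite natrB; [field|lia].
by rewrite sum1 -/(reg_mean m alpha); ring.
Qed.

Hypothesis alpha_ge0 : forall k, (k <= m)%N -> 0 <= alpha k.
Hypothesis alpha0_gt0 : 0 < alpha 0%N.

(** [- c_reg] is the variance of the probability vector [alpha], which
    charges 0 and has a positive mean. *)
Lemma c_reg_lt0 : reg_weights m alpha -> c_reg m alpha < 0.
Proof.
move=> [sum1 alpha0_lt1].
have mean_gt0 : 0 < reg_mean m alpha.
  have : 0 < 1 - alpha 0%N by rewrite subr_gt0.
  move=> /lt_le_trans; apply; rewrite -sum1 /reg_mean.
  rewrite [in leLHS]big_ltn// [in leRHS]big_ltn// mulr0 add0r.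
  rewrite addrAC subrr add0r !big_nat; apply: ler_sum => k k1.
  by rewrite ler_peMr ?alpha_ge0 ?ler1n//; lia.
have -> : c_reg m alpha =
    - \sum_(0 <= k < m.+1) alpha k * (k%:R - reg_mean m alpha) ^+ 2.
  transitivity (- (\sum_(0 <= k < m.+1) alpha k * k%:R ^+ 2
    - 2 * reg_mean m alpha * \sum_(0 <= k < m.+1) alpha k * k%:R
    + reg_mean m alpha ^+ 2 * \sum_(0 <= k < m.+1) alpha k)).
    by rewrite sum1 /c_reg -/(reg_mean m alpha); ring.
  move: (reg_mean m alpha) => mean; rewrite !mulr_sumr -sumrB -big_split/=.
  congr (- _).
  by apply: eq_bigr => k _; ring.
rewrite oppr_lt0 big_ltn// sub0r sqrrN.
apply: ltr_pwDl; first by rewrite mulr_gt0 ?exprn_gt0.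
rewrite big_nat; apply: sumr_ge0 => k k1.
by rewrite mulr_ge0 ?sqr_ge0// alpha_ge0//; lia.
Qed.

(** Completing squares first in the intercept [log2 p.2], whose best value for a
    given slope makes the line pass through the means, and then in the slope
    [p.1]. *)
Lemma reg_lossE (n : nat) (x : R -> R) (p : R * R) : (m < n)%N ->
  reg_weights m alpha ->
  let y k := (n%:R - k%:R) * Rhat (n - k) x in
  let h0 := reg_fit n (Rhat^~ x) in
  let ybar := reg_ybar n (Rhat^~ x) in
  let tbar := n%:R - reg_mean m alpha in
  reg_loss m alpha n x p =
    \sum_(0 <= k < m.+1) alpha k * y k ^+ 2 - ybar ^+ 2
      + c_reg m alpha * h0 ^+ 2
    + (- c_reg m alpha * (p.1 - h0) ^+ 2
       + (log2 p.2 - (ybar - tbar * p.1)) ^+ 2).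
Proof.
move=> mn wts y h0 ybar tbar; case: p => h l /=.
have c0 := c_reg_lt0 wts; case: wts => sum1 _.
set a := reg_mean m alpha in tbar *; set mu := log2 l.
set S2 := \sum_(0 <= k < m.+1) alpha k * k%:R ^+ 2.
have cE : c_reg m alpha = a ^+ 2 - S2 by [].
(* The fitted slope is the covariance of design and response divided by the
   variance of the design. Here [SK - a * ybar] is minus the covariance, since
   the design [n - k] decreases in [k], and [c_reg] is minus the variance. *)
set SK := \sum_(0 <= k < m.+1) alpha k * k%:R * y k.
have h0E : c_reg m alpha * h0 = SK - a * ybar.
  rewrite /h0 /reg_fit div1r mulrA mulfV ?lt_eqF// mul1r.
  rewrite /SK /ybar /reg_ybar mulr_sumr -sumrB.
  by apply: eq_bigr => k _; rewrite /y /a; ring.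
have -> : reg_loss m alpha n x (h, l) =
    \sum_(0 <= k < m.+1) alpha k * y k ^+ 2
    + 2 * h * SK - 2 * (n%:R * h + mu) * ybar
    + h ^+ 2 * S2 - 2 * h * (n%:R * h + mu) * a
    + (n%:R * h + mu) ^+ 2 * \sum_(0 <= k < m.+1) alpha k.
  rewrite /SK /ybar /reg_ybar /S2 /a /reg_mean !mulr_sumr.
  rewrite -!(big_split, sumrB)/= /reg_loss !big_nat; apply: eq_bigr => k k1.
  by rewrite /= /y natrB; [rewrite /mu; ring|lia].
have SKE : SK = c_reg m alpha * h0 + a * ybar by rewrite h0E; ring.
have S2E : S2 = a ^+ 2 - c_reg m alpha by rewrite cE; ring.
by rewrite sum1 SKE S2E /tbar; ring.
Qed.

Lemma reg_argminE (n : nat) (x : R -> R) : (m < n)%N ->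
  reg_weights m alpha ->
  reg_argmin m alpha n x =
    [set (reg_fit n (Rhat^~ x),
          2 `^ (reg_ybar n (Rhat^~ x)
                - (n%:R - reg_mean m alpha) * reg_fit n (Rhat^~ x)))].
Proof.
move=> mn wts; have c0 := c_reg_lt0 wts.
apply: (argmin_residual _ (fun p _ => reg_lossE x p mn wts)).
- by rewrite /= powR_gt0.
- by move=> p _; rewrite addr_ge0 ?sqr_ge0// mulr_ge0 ?sqr_ge0// oppr_ge0 ltW.
move=> [h l] /= l0; split => [/eqP|[-> ->]]; last first.
  by rewrite log2_powR !subrr !expr0n/= mulr0 addr0.
rewrite paddr_eq0 ?sqr_ge0//; last by rewrite mulr_ge0 ?sqr_ge0// oppr_ge0 ltW.
rewrite mulf_eq0 oppr_eq0 lt_eqF//= !expf_eq0/= !subr_eq0.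
move=> /andP[/eqP -> /eqP le]; congr pair.
by apply: log2_inj => //; rewrite ?powR_gt0// log2_powR.
Qed.

Lemma reg_estimateE (n : nat) (x : R -> R) : (m < n)%N ->
  reg_weights m alpha -> reg_estimate m alpha n x = reg_fit n (Rhat^~ x).
Proof. by move=> mn wts; rewrite /reg_estimate (get_set1 (reg_argminE x mn wts)). Qed.

(** The coefficients of [reg_fit] add up to 1, so [rho] can be subtracted from
    every value of [r], and they are of order [n]. *)
Lemma reg_fit_close (n : nat) (r : nat -> R) (rho e : R) : (m < n)%N ->
  reg_weights m alpha ->
  (forall k, (n - m <= k <= n)%N -> `|r k - rho| <= e) ->
  `|reg_fit n r - rho| <=
    (\sum_(0 <= k < m.+1) `|alpha k * (k%:R - reg_mean m alpha)|)
      / `|c_reg m alpha| * (n%:R * e).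
Proof.
move=> mn wts re; have c0 := c_reg_lt0 wts; case: (wts) => sum1 _.
have -> : reg_fit n r - rho = 1 / c_reg m alpha *
    \sum_(0 <= k < m.+1) alpha k * (n%:R - k%:R)
      * (k%:R - reg_mean m alpha) * (r (n - k)%N - rho).
  transitivity (1 / c_reg m alpha * (\sum_(0 <= k < m.+1) alpha k
      * (n%:R - k%:R) * (k%:R - reg_mean m alpha) * r (n - k)%N
    - rho * (n%:R * \sum_(0 <= k < m.+1) alpha k * k%:R
      - n%:R * reg_mean m alpha * \sum_(0 <= k < m.+1) alpha k
      - \sum_(0 <= k < m.+1) alpha k * k%:R ^+ 2
      + reg_mean m alpha * \sum_(0 <= k < m.+1) alpha k * k%:R))).
    rewrite sum1 /reg_fit mulrBr; congr (_ - _).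
    transitivity (1 / c_reg m alpha * (c_reg m alpha * rho)).
      by field; rewrite lt_eqF.
    by congr (_ * _); rewrite /c_reg -/(reg_mean m alpha); ring.
  congr (_ * _); move: (reg_mean m alpha) => mean; rewrite !mulr_sumr -!(sumrB, big_split)/=.
  rewrite mulr_sumr -sumrB.
  by apply: eq_bigr => k _; ring.
rewrite normrM div1r normfV mulrAC mulrC ler_wpM2r ?invr_ge0//.
rewrite mulr_suml; apply: le_trans (ler_norm_sum _ _ _) _.
rewrite !big_nat; apply: ler_sum => k k1.
have nk0 : 0 <= n%:R - k%:R :> R by rewrite subr_ge0 ler_nat; lia.
rewrite (_ : alpha k * (n%:R - k%:R) * (k%:R - reg_mean m alpha)
    * (r (n - k)%N - rho) = alpha k * (k%:R - reg_mean m alpha)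
    * ((n%:R - k%:R) * (r (n - k)%N - rho))); last by ring.
rewrite normrM ler_wpM2l// normrM (ger0_norm nk0).
by apply: ler_pM; rewrite ?normr_ge0// ?re ?gerBl ?ler0n//; lia.
Qed.

End Regression.

(** * Transfer of the convergence rate *)

(** Iterating [a n = O(a n.+1)] at most [m] times bounds the earlier terms of the
    window by its last one. *)
Lemma bigO_window (R : realType) (m : nat) (f a : nat -> R) :
  f =O_\oo a -> a =O_\oo (fun n => a n.+1) ->
  exists2 C, 0 < C & \forall n \near \oo,
    forall k, (n - m <= k <= n)%N -> `|f k| <= C * `|a n|.
Proof.
move=> /eqO_exP[C C0 [N1 _ fa]] /eqO_exP[K0 K00 [N2 _ aa]].
pose K := Num.max 1 K0; have K1 : 1 <= K by rewrite le_max lexx.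
have aS n : (N2 <= n)%N -> `|a n| <= K * `|a n.+1|.
  by move=> /aa/= /le_trans; apply; rewrite ler_wpM2r// le_max lexx orbT.
have aD d n : (N2 <= n)%N -> `|a n| <= K ^+ d * `|a (n + d)%N|.
  move=> n2; elim: d => [|d IHd]; first by rewrite mul1r addn0.
  apply: le_trans IHd _; rewrite exprSr -mulrA addnS ler_wpM2l ?exprn_ge0//.
    by rewrite (le_trans _ K1).
  by apply: aS; lia.
exists (C * K ^+ m); first by rewrite mulr_gt0// exprn_gt0// (lt_le_trans _ K1).
near=> n => k nk.
have n1 : (N1 + N2 + m <= n)%N by near: n; exact: nbhs_infty_ge.
apply: le_trans (fa k _) _; first by rewrite /=; lia.
rewrite -mulrA ler_wpM2l ?(ltW C0)//.
apply: le_trans (aD (n - k)%N k _) _; first by lia.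
rewrite (_ : (k + (n - k) = n)%N); last by lia.
by rewrite ler_wpM2r// ler_weXn2l//; lia.
Unshelve. all: by end_near. Qed.

Lemma bigO_natr (R : realType) (f a : nat -> R) (K C : R) : 0 <= K -> 0 < C ->
  (\forall n \near \oo, `|f n| <= K * (n%:R * (C * `|a n|))) ->
  f =O_\oo (fun n => n%:R * a n).
Proof.
move=> K0 C0 fK; apply/eqO_exP; exists (K * C + 1).
  by rewrite ltr_wpDl// mulr_ge0// ltW.
near=> n; apply: (@le_trans _ _ (K * (n%:R * (C * `|a n|)))).
  by near: n; exact: fK.
rewrite normrM normr_nat mulrDl mul1r.
rewrite (_ : K * (n%:R * (C * `|a n|)) = K * C * (n%:R * `|a n|)); last by ring.
by rewrite lerDl mulr_ge0.
Unshelve. all: by end_near. Qed.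

Section Estimates.
Context {R : realType} (m : nat) (alpha : nat -> R).
Hypothesis alpha_ge0 : forall k, (k <= m)%N -> 0 <= alpha k.
Hypothesis alpha0_gt0 : 0 < alpha 0%N.

Lemma seq_estimateE (n : nat) (x : R -> R) : scale_defined m n x ->
  seq_estimate m alpha n x = pair_fit m alpha id n (Rhat^~ x).
Proof. by move=> dx; apply: Rhat_argmin => //; exact: forward_id. Qed.

Lemma term_estimateE (n : nat) (x : R -> R) : scale_defined m n x ->
  term_estimate m alpha n x = pair_fit m alpha (fun=> n) n (Rhat^~ x).
Proof. by move=> dx; apply: Rhat_argmin => //; exact: forward_const. Qed.

Lemma scale_defined_scale (n : nat) (l : R) (x : R -> R) :
  l != 0 -> scale_defined m n x -> scale_defined m n (scale l x).
Proof. by move=> l0 dx k nk; apply: Rhat_defined_scale => //; exact: dx. Qed.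

Lemma pair_fit_scale (p : nat -> nat) (n : nat) (l : R) (x : R -> R) :
  forward m n p -> l != 0 -> scale_defined m n x ->
  pair_fit m alpha p n (Rhat^~ (scale l x)) = pair_fit m alpha p n (Rhat^~ x).
Proof.
move=> pf l0 dx; apply: (pair_fit_shift alpha_ge0 alpha0_gt0 (mu := log2 `|l|)) => //.
  exact: scale_defined_gt dx.
by move=> k nk; apply: Rhat_scale => //; exact: dx.
Qed.

Lemma reg_fit_scale (n : nat) (l : R) (x : R -> R) :
  (m < n)%N -> reg_weights m alpha -> l != 0 -> reg_defined m n x ->
  reg_fit m alpha n (Rhat^~ (scale l x)) = reg_fit m alpha n (Rhat^~ x).
Proof.
move=> mn wts l0 dx; apply: (reg_fit_shift (mu := log2 `|l|)) => // k nk.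
by apply: Rhat_scale => //; exact: dx.
Qed.

(** By scale invariance the estimates of [x] are those of [scale l x], whose
    values [Rhat k] are already known to be close to [rho]. *)
Lemma estimates_bigO (x : R -> R) (rho l : R) (a : nat -> R) :
  (\forall n \near \oo, Rhat_defined n x) -> l != 0 ->
  (fun n => Rhat n (scale l x) - rho) =O_\oo a ->
  a =O_\oo (fun n => a n.+1) ->
  [/\ (fun n => seq_estimate m alpha n x - rho) =O_\oo (fun n => n%:R * a n),
      (fun n => term_estimate m alpha n x - rho) =O_\oo (fun n => n%:R * a n)
    & reg_weights m alpha ->
      (fun n => reg_estimate m alpha n x - rho) =O_\oo (fun n => n%:R * a n)].
Proof.
move=> [N _ dN] l0 Oa aS.
have [C C0 close] := bigO_window m.+1 Oa aS.
have dx n : (N + m.+2 <= n)%N -> scale_defined m n x.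
  by move=> nN k nk; apply: dN => /=; lia.
have pairK0 : 0 <= 1 + 4 * m.+1%:R * (\sum_(0 <= k < m.+1) alpha k) / alpha 0%N.
  rewrite addr_ge0// divr_ge0 ?(ltW alpha0_gt0)// mulr_ge0 ?mulr_ge0//.
  by rewrite big_nat; apply: sumr_ge0 => k k1; apply: alpha_ge0; lia.
split.
- apply: bigO_natr pairK0 C0 _; near=> n.
  have nN : (N + m.+2.*2 <= n)%N by near: n; exact: nbhs_infty_ge.
  have dn : scale_defined m n x by apply: dx; lia.
  rewrite seq_estimateE// -(pair_fit_scale (@forward_id _ _) l0 dn).
  apply: pair_fit_close => //; [lia|lia|exact: forward_id|].
  by near: n; exact: close.
- apply: bigO_natr pairK0 C0 _; near=> n.
  have nN : (N + m.+2.*2 <= n)%N by near: n; exact: nbhs_infty_ge.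
  have dn : scale_defined m n x by apply: dx; lia.
  rewrite term_estimateE// -(pair_fit_scale (@forward_const _ _) l0 dn).
  apply: pair_fit_close => //; [lia|lia|exact: forward_const|].
  by near: n; exact: close.
move=> wts.
apply: (@bigO_natr _ _ _ ((\sum_(0 <= k < m.+1)
  `|alpha k * (k%:R - reg_mean m alpha)|) / `|c_reg m alpha|) _ _ C0).
  by rewrite divr_ge0// sumr_ge0.
near=> n.
have nN : (N + m.+2.*2 <= n)%N by near: n; exact: nbhs_infty_ge.
have mn : (m < n)%N by lia.
have dn : reg_defined m n x by move=> k nk; apply: (dx n); lia.
rewrite reg_estimateE// -(reg_fit_scale mn wts l0 dn).
apply: reg_fit_close => // k nk.
suff H : forall k, (n - m.+1 <= k <= n)%N ->
    `|Rhat k (scale l x) - rho| <= C * `|a n| by apply: H; lia.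
by near: n; exact: close.
Unshelve. all: by end_near. Qed.

End Estimates.

(** * The theorem *)

Theorem proposition8p3 (R : realType) (m : nat) (alpha : nat -> R)
    (m_gt0 : (0 < m)%N)
    (alpha_ge0 : forall k, (k <= m)%N -> 0 <= alpha k)
    (alpha0_gt0 : 0 < alpha 0%N) :
  [/\ forall (n : nat) (x : R -> R), (m < n)%N ->
        {within `[0, 1], continuous x} ->
        [/\ scale_defined m n x -> exists! l, seq_argmin m alpha n x l,
            scale_defined m n x -> exists! l, term_argmin m alpha n x l
          & reg_weights m alpha -> reg_defined m n x ->
            exists! p, reg_argmin m alpha n x p],
      forall (n : nat) (x : R -> R), (m < n)%N ->
        {within `[0, 1], continuous x} ->
        [/\ scale_defined m n x ->
            seq_estimate m alpha n x =
              \sum_(n - m.+1 <= k < n.+1) beta m alpha n k * Rhat k x,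
            scale_defined m n x ->
            term_estimate m alpha n x =
              \sum_(n - m.+1 <= k < n.+1) gamma m alpha n k * Rhat k x
          & reg_weights m alpha -> reg_defined m n x ->
            reg_estimate m alpha n x =
              1 / c_reg m alpha *
              \sum_(0 <= k < m.+1)
                alpha k * (n%:R - k%:R) * (k%:R - reg_mean m alpha)
                * Rhat (n - k) x],
      forall (n : nat) (x : R -> R) (l : R), (m < n)%N ->
        {within `[0, 1], continuous x} -> l != 0 ->
        [/\ scale_defined m n x ->
            term_estimate m alpha n (scale l x) = term_estimate m alpha n x,
            scale_defined m n x ->
            seq_estimate m alpha n (scale l x) = seq_estimate m alpha n x
          & reg_weights m alpha -> reg_defined m n x ->
            reg_estimate m alpha n (scale l x) = reg_estimate m alpha n x]
    & forall (x : R -> R) (rho l : R) (a : nat -> R),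
        {within `[0, 1], continuous x} ->
        (\forall n \near \oo, Rhat_defined n x) ->
        roughness_exponent x rho -> l != 0 ->
        (fun n => Rhat n (scale l x) - rho) =O_\oo a ->
        a =o_\oo (fun n => n%:R^-1 : R) ->
        a =O_\oo (fun n => a n.+1) ->
        [/\ (fun n => seq_estimate m alpha n x - rho)
              =O_\oo (fun n => n%:R * a n),
            (fun n => term_estimate m alpha n x - rho)
              =O_\oo (fun n => n%:R * a n)
          & reg_weights m alpha ->
            (fun n => reg_estimate m alpha n x - rho)
              =O_\oo (fun n => n%:R * a n)] ].
Proof.
split.
- move=> n x mn _; split=> [dx|dx|wts dx].
  + by apply: set1_exists_unique; apply: pair_argmin => //; exact: forward_id.
  + by apply: set1_exists_unique; apply: pair_argmin => //; exact: forward_const.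
  + exact: set1_exists_unique (reg_argminE alpha_ge0 alpha0_gt0 x mn wts).
- move=> n x mn _; split=> [dx|dx|wts dx].
  + by rewrite seq_estimateE// pair_fit_seq//; exact: scale_defined_gt dx.
  + by rewrite term_estimateE// pair_fit_term//; exact: scale_defined_gt dx.
  + by rewrite reg_estimateE.
- move=> n x l mn _ l0; split=> [dx|dx|wts dx].
  + have dlx := scale_defined_scale l0 dx.
    rewrite (term_estimateE alpha_ge0 alpha0_gt0 dlx).
    rewrite (term_estimateE alpha_ge0 alpha0_gt0 dx).
    exact (pair_fit_scale alpha_ge0 alpha0_gt0 (@forward_const m n) l0 dx).
  + have dlx := scale_defined_scale l0 dx.
    rewrite (seq_estimateE alpha_ge0 alpha0_gt0 dlx).
    rewrite (seq_estimateE alpha_ge0 alpha0_gt0 dx).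
    exact (pair_fit_scale alpha_ge0 alpha0_gt0 (@forward_id m n) l0 dx).
  + rewrite (reg_estimateE alpha_ge0 alpha0_gt0 (scale l x) mn wts).
    rewrite (reg_estimateE alpha_ge0 alpha0_gt0 x mn wts).
    exact: reg_fit_scale mn wts l0 dx.
- move=> x rho l a _ dx _ l0 Oa _ aS.
  exact: estimates_bigO dx l0 Oa aS.
Qed.
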